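(* Let $\mathbb{F}$ be a nonstandard finite field of characteristic zero, and let $P:\mathbb{F}^2\to\mathbb{F}$ be a polynomial (with coefficients in $\mathbb{F}$) such that the set $\{(P(a,c),P(a,d),P(b,c),P(b,d)): a,b,c,d\in\mathbb{F}\}$ is not Zariski dense in $\overline{\mathbb{F}}^4$. Then one of the following holds: (i) (Additive structure) there exist polynomials $Q,F,G:\mathbb{F}\to\mathbb{F}$ such that $P(x,y)=Q(F(x)+G(y))$ for all $x,y\in\mathbb{F}$; (ii) (Multiplicative structure) there exist polynomials $Q,F,G:\mathbb{F}\to\mathbb{F}$ such that $P(x,y)=Q(F(x)G(y))$ for all $x,y\in\mathbb{F}$.
   Context: Fix a non-principal ultrafilter $\alpha$ on $\mathbb{N}$. A nonstandard finite field is an ultraproduct $\mathbb{F}=\prod_{\mathfrak n\to\alpha}\mathbb{F}_{\mathfrak n}$ of finite fields (sequences modulo agreement on $\alpha$-large sets of indices); it has characteristic zero if no prime $p$ is the characteristic of $\mathbb{F}_{\mathfrak n}$ for $\alpha$-almost all $\mathfrak n$. $\overline{\mathbb{F}}$ denotes its algebraic closure. A polynomial here means an ordinary polynomial of (standard) finite degree with coefficients in $\mathbb{F}$, equivalently an ultralimit of polynomials $P_{\mathfrak n}$ over $\mathbb{F}_{\mathfrak n}$ of uniformly bounded degree. *)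

(* Defs.v *)
From HB Require Import structures.
From mathcomp Require Import all_boot all_algebra.
From mathcomp Require Import boolp classical_sets filter.
From mathcomp Require Import generic_quotient mpoly.

Set Implicit Arguments.
Unset Strict Implicit.
Unset Printing Implicit Defensive.

Import GRing.Theory.

Local Open Scope classical_set_scope.
Local Open Scope ring_scope.
Local Open Scope quotient_scope.

Section Ultraproduct.
Variables (alpha : set_system nat) (UF : UltraFilter alpha).
Variable Fn : nat -> finFieldType.


Definition useq : Type := forall n, Fn n.
HB.instance Definition _ := Choice.on useq.

(* \forall n \near alpha, P n  unfolds to  alpha [set n | P n]. *)
Definition ueq (u v : useq) : bool := `[< \forall n \near alpha, u n = v n >].

Let ueq_refl : reflexive ueq.
Proof. by move=> u; apply/asboolP; near=> n. Unshelve. all: by end_near. Qed.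

Let ueq_sym : ssrbool.symmetric ueq.
Proof.
by move=> u v; apply/asboolP/asboolP; apply: filterS => n ->.
Qed.

Let ueq_trans : transitive ueq.
Proof.
move=> v u w /asboolP uv /asboolP vw; apply/asboolP.
by apply: filterS2 uv vw => n -> ->.
Qed.

Canonical ueq_equiv := EquivRel ueq ueq_refl ueq_sym ueq_trans.

Definition ultraproduct : Type := {eq_quot ueq}.
HB.instance Definition _ := Choice.on ultraproduct.
HB.instance Definition _ := EqQuotient.on ultraproduct.

Definition ulim (u : useq) : ultraproduct := \pi_ultraproduct u.

Lemma ulimP (u v : useq) :
  ulim u = ulim v <-> \forall n \near alpha, u n = v n.
Proof. by split=> [/eqmodP/asboolP|h]; last by apply/eqmodP/asboolP. Qed.

Lemma ulim_repr (x : ultraproduct) : ulim (repr x) = x.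
Proof. exact: reprK. Qed.

Let repr_ulim (u : useq) : \forall n \near alpha, repr (ulim u) n = u n.
Proof. by apply/ulimP; rewrite ulim_repr. Qed.

Let uadd (x y : ultraproduct) := ulim (fun n => repr x n + repr y n).
Let uopp (x : ultraproduct) := ulim (fun n => - repr x n).
Let umul (x y : ultraproduct) := ulim (fun n => repr x n * repr y n).
Let uinv (x : ultraproduct) := ulim (fun n => (repr x n)^-1).
Let uzero := ulim (fun=> 0).
Let uone := ulim (fun=> 1).

Let uaddE u v : uadd (ulim u) (ulim v) = ulim (fun n => u n + v n).
Proof.
apply/ulimP; have := repr_ulim v; have := repr_ulim u.
by apply: filterS2 => n -> ->.
Qed.

Let uoppE u : uopp (ulim u) = ulim (fun n => - u n).
Proof. by apply/ulimP; have := repr_ulim u; apply: filterS => n ->. Qed.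

Let umulE u v : umul (ulim u) (ulim v) = ulim (fun n => u n * v n).
Proof.
apply/ulimP; have := repr_ulim v; have := repr_ulim u.
by apply: filterS2 => n -> ->.
Qed.

Let uinvE u : uinv (ulim u) = ulim (fun n => (u n)^-1).
Proof. by apply/ulimP; have := repr_ulim u; apply: filterS => n ->. Qed.

Let ulim_ext (u v : useq) : (forall n, u n = v n) -> ulim u = ulim v.
Proof. by move=> uv; apply/ulimP; apply: filterE. Qed.

Let uaddA : associative uadd.
Proof.
move=> x y z; rewrite -(ulim_repr x) -(ulim_repr y) -(ulim_repr z) !uaddE.
by apply: ulim_ext => n; rewrite addrA.
Qed.

Let uaddC : commutative uadd.
Proof. by move=> x y; apply: ulim_ext => n; rewrite addrC. Qed.

Let uadd0 : left_id uzero uadd.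
Proof.
move=> x; rewrite -(ulim_repr x) uaddE.
by apply: ulim_ext => n; rewrite add0r.
Qed.

Let uaddN : left_inverse uzero uopp uadd.
Proof.
move=> x; rewrite -(ulim_repr x) uoppE uaddE.
by apply: ulim_ext => n; rewrite addNr.
Qed.

HB.instance Definition _ :=
  GRing.isZmodule.Build ultraproduct uaddA uaddC uadd0 uaddN.

Let umulA : associative umul.
Proof.
move=> x y z; rewrite -(ulim_repr x) -(ulim_repr y) -(ulim_repr z) !umulE.
by apply: ulim_ext => n; rewrite mulrA.
Qed.

Let umulC : commutative umul.
Proof. by move=> x y; apply: ulim_ext => n; rewrite mulrC. Qed.

Let umul1 : left_id uone umul.
Proof.
move=> x; rewrite -(ulim_repr x) umulE.
by apply: ulim_ext => n; rewrite mul1r.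
Qed.

Let umulD : left_distributive umul uadd.
Proof.
move=> x y z; rewrite -(ulim_repr x) -(ulim_repr y) -(ulim_repr z).
rewrite !(uaddE, umulE).
by apply: ulim_ext => n; rewrite mulrDl.
Qed.

Let uone_neq0 : uone != uzero.
Proof.
apply/eqP => /ulimP h; apply: (@filter_not_empty _ alpha _).
by apply: filterS h => n /eqP; rewrite oner_eq0.
Qed.

HB.instance Definition _ :=
  GRing.Zmodule_isComNzRing.Build ultraproduct
    umulA umulC umul1 umulD uone_neq0.

Let umulV (x : ultraproduct) : x != 0 -> uinv x * x = 1.
Proof.
move=> /eqP x0; rewrite -(ulim_repr x) uinvE; apply: etrans (umulE _ _) _.
apply/ulimP; case: (in_ultra_setVsetC [set n | repr x n = 0] UF) => [h|].
  by case: x0; rewrite -(ulim_repr x); apply/ulimP.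
by apply: filterS => n /= /eqP xn0; rewrite mulVf.
Qed.

Let uinv0 : uinv 0 = 0.
Proof. by rewrite [LHS]uinvE; apply: ulim_ext => n; rewrite invr0. Qed.

HB.instance Definition _ :=
  GRing.ComNzRing_isField.Build ultraproduct umulV uinv0.

Lemma ulimD u v : ulim u + ulim v = ulim (fun n => u n + v n).
Proof. exact: uaddE. Qed.

Lemma ulimN u : - ulim u = ulim (fun n => - u n).
Proof. exact: uoppE. Qed.

Lemma ulimM u v : ulim u * ulim v = ulim (fun n => u n * v n).
Proof. exact: umulE. Qed.

Lemma ulimV u : (ulim u)^-1 = ulim (fun n => (u n)^-1).
Proof. exact: uinvE. Qed.

Lemma ulim0 : ulim (fun=> 0) = 0. Proof. by []. Qed.
Lemma ulim1 : ulim (fun=> 1) = 1. Proof. by []. Qed.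

End Ultraproduct.

Definition nonprincipal (alpha : set_system nat) : Prop :=
  forall n, alpha <> principal_filter n.

Definition ultra_char0 (alpha : set_system nat) (Fn : nat -> finFieldType) :
    Prop :=
  forall p, prime p -> ~ \forall n \near alpha, p \in [pchar (Fn n)].

(* The libraries construct algebraic closures of countable fields only, so
   closures are characterized: an algebraically closed L together with an
   embedding of K over which every element of L is algebraic. *)
Definition is_algebraic_closure (K : fieldType) (L : closedFieldType)
    (iota : {rmorphism K -> L}) : Prop :=
  forall z : L, algebraicOver iota z.

Section Zariski.
Variables (K : fieldType) (n : nat).

Definition zero_locus (S : set {mpoly K[n]}) : set (n.-tuple K) :=
  [set v | forall p, S p -> p.@[tnth v] = 0].

Definition zariski_closed (Z : set (n.-tuple K)) : Prop :=
  exists S : set {mpoly K[n]}, Z = zero_locus S.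

Definition zariski_dense (X : set (n.-tuple K)) : Prop :=
  forall Z, zariski_closed Z -> X `<=` Z -> Z = setT.

End Zariski.

Definition eval2 (K : fieldType) (P : {mpoly K[2]}) (x y : K) : K :=
  P.@[tnth [tuple x; y]].

Definition quad_values (K : fieldType) (L : closedFieldType)
    (iota : {rmorphism K -> L}) (P : {mpoly K[2]}) : set (4.-tuple L) :=
  [set v | exists a b c d : K,
     v = [tuple iota (eval2 P a c); iota (eval2 P a d);
                iota (eval2 P b c); iota (eval2 P b d)]].

(* Main.v *)
Require Import Defs.
From HB Require Import structures.
From mathcomp Require Import all_boot all_algebra.
From mathcomp Require Import boolp classical_sets filter.
From mathcomp Require Import mpoly ring zify.

Set Implicit Arguments.
Unset Strict Implicit.
Unset Printing Implicit Defensive.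

Import GRing.Theory.
Local Open Scope ring_scope.

(**
Write P_x, P_y for the partial derivatives and assume that neither vanishes. An
algebraic relation between P(a,c), P(a,d), P(b,c), P(b,d) forces, in
characteristic zero, the Jacobian of these four polynomials in a, b, c, d to
vanish, which says
  P_x(a,c) P_y(a,d) P_y(b,c) P_x(b,d) = P_x(a,d) P_x(b,c) P_y(a,c) P_y(b,d).
Fixing b and d separates the variables: u(x) v(y) P_x = w(x) t(y) P_y. All that
follows is read off at infinity, hence needs no field extension. Comparing the
leading terms in x gives deg u <= deg w + 1.
- If deg u <= deg w, then t divides v, and symmetrically u divides w, so that
  G' P_x = F' P_y for polynomials F(x) and G(y). The quotient P_x / F' is again
  a polynomial solution, and integrating it shows by induction that P is a
  polynomial in F + G.
- If deg u = deg w + 1, the leading coefficients of P in y and in x form a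
  product solution X(x) Y(y) of the same degree in x as P. By a Euclidean
  argument all product solutions are, up to constants, powers of one of them,
  F(x) G(y), and subtracting multiples of its powers reduces P to a constant.
*)

(** * Derivations of bivariate polynomials *)

Section DerivCharZero.
Variables (R : idomainType) (R0 : forall n, n.+1%:R != 0 :> R).
Implicit Types p : {poly R}.

Lemma mulrSn_eq0 (x : R) n : (x *+ n.+1 == 0) = (x == 0).
Proof. by rewrite -mulr_natr mulf_eq0 (negPf (R0 n)) orbF. Qed.

Lemma natr_inj_char0 : injective (fun n => n%:R : R).
Proof.
suff le_inj m n : (m <= n)%N -> m%:R = n%:R :> R -> m = n.
  by move=> m n; case: (leqP m n) => [/le_inj//|/ltnW/le_inj h /esym/h].
move=> mn /eqP; rewrite eq_sym -subr_eq0 -natrB //.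
by case E: (n - m)%N => [|k]; [lia | rewrite (negPf (R0 k))].
Qed.

Lemma deriv_eq0_const p : p^`() = 0 -> p = (p`_0)%:P.
Proof.
move=> p0; apply/polyP => -[|i]; rewrite coefC //=.
have /eqP : p^`()`_i = 0 by rewrite p0 coef0.
by rewrite coef_deriv mulrSn_eq0 => /eqP.
Qed.

Lemma size_deriv_char0 p : size p^`() = (size p).-1.
Proof.
have [->|p0] := eqVneq p 0; first by rewrite deriv0 size_poly0.
apply/eqP; rewrite eqn_leq; apply/andP; split.
  by have := lt_size_deriv p0; case: (size p).
case E: (size p) => [|[|n]] //=.
rewrite ltnNge; apply/negP => /leq_sizeP/(_ n (leqnn n))/eqP.
rewrite coef_deriv mulrSn_eq0.
by have := p0; rewrite -lead_coef_eq0 lead_coefE E => /negPf->.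
Qed.

Lemma natr_poly_char0 n : n.+1%:R != 0 :> {poly R}.
Proof. by rewrite -polyC_natr polyC_eq0. Qed.

End DerivCharZero.

Lemma vanish_on_infinite (R : idomainType) (x : nat -> R) (p : {poly R}) :
  injective x -> (forall n, p.[x n] = 0) -> p = 0.
Proof.
move=> x_inj px; apply/eqP/negPn/negP => p0.
have := @max_poly_roots _ p (map x (iota 0 (size p))) p0.
rewrite size_map size_iota ltnn map_inj_uniq // iota_uniq => h.
by have : false by apply: h => //; apply/allP => _ /mapP[n _ ->]; apply/eqP/px.
Qed.

(** Only one term of the convolution can reach degree m + n. The bounds need not be sharp, so a
    factor may have lower degree. *)
Lemma coefM_top (R : nzRingType) (p q : {poly R}) m n :
  (size p <= m.+1)%N -> (size q <= n.+1)%N -> (p * q)`_(m + n) = p`_m * q`_n.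
Proof.
move=> pm qn; rewrite coefM.
have mlt : (m < (m + n).+1)%N by rewrite ltnS leq_addr.
rewrite (bigD1 (Ordinal mlt)) //= addKn big1 ?addr0 // => -[i ilt].
rewrite -val_eqE /= => im; have [lt_im|lt_mi|eq_im] := ltngtP i m.
- by rewrite [q`__]nth_default ?mulr0 //; apply: leq_trans qn _; lia.
- by rewrite nth_default ?mul0r //; apply: leq_trans pm _; lia.
- by rewrite eq_im eqxx in im.
Qed.

Section CharZero.
Variables (K : fieldType) (K0 : forall n, n.+1%:R != 0 :> K).
Implicit Types (a b c d F G Q X : {poly K}) (p q : {poly {poly K}}).

Let A0 : forall n, n.+1%:R != 0 :> {poly K} := natr_poly_char0 K0.

Lemma antiderivative X : exists Q, Q^`() = X.
Proof.
(* At index 0 the coefficient is a division by zero, hence 0, and the derivative does not see it. *)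
exists (\poly_(i < (size X).+1) (X`_i.-1 / i%:R)).
apply/polyP => i; rewrite coef_deriv coef_poly ltnS /=.
case: ltnP => [_|le_Xi]; last by rewrite mul0rn nth_default.
by rewrite -[LHS]mulr_natr divfK.
Qed.

(** The inner variable y is brought outside and back, so that the laws of the univariate derivative
    transfer. *)
Definition derivY p : {poly {poly K}} := swapXY (swapXY p)^`().

Lemma coef_derivY p i : (derivY p)`_i = (p`_i)^`().
Proof.
apply/polyP => j.
by rewrite coef_swapXY !coef_deriv coefMn coef_swapXY.
Qed.

Lemma derivY_sub : zmod_morphism derivY.
Proof.
by move=> p q; rewrite /derivY (raddfB swapXY) derivB (raddfB swapXY).
Qed.
HB.instance Definition _ :=
  GRing.isZmodMorphism.Build {poly {poly K}} {poly {poly K}} derivY derivY_sub.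

Lemma derivYD p q : derivY (p + q) = derivY p + derivY q.
Proof. exact: raddfD. Qed.

Lemma derivYM p q : derivY (p * q) = derivY p * q + p * derivY q.
Proof. by rewrite /derivY rmorphM derivM rmorphD !rmorphM /= !swapXYK. Qed.

Lemma derivY_polyC a : derivY a%:P = (a^`())%:P.
Proof. by rewrite /derivY swapXY_polyC deriv_map swapXY_map_polyC. Qed.

Lemma derivY_map a : derivY a^:P = 0.
Proof. by rewrite /derivY swapXY_map_polyC derivC rmorph0. Qed.

Lemma deriv_derivY p : (derivY p)^`() = derivY p^`().
Proof.
by apply/polyP => i; rewrite coef_deriv !coef_derivY coef_deriv derivMn.
Qed.

Lemma derivY_comp Q p : derivY (Q^:P \Po p) = (Q^`()^:P \Po p) * derivY p.
Proof.
rewrite /derivY swapXY_comp_poly deriv_comp rmorphM /= deriv_map.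
by rewrite swapXY_comp_poly swapXYK.
Qed.

Lemma swapXY_deriv p : swapXY p^`() = derivY (swapXY p).
Proof. by rewrite /derivY swapXYK. Qed.

Lemma swapXY_derivY p : swapXY (derivY p) = (swapXY p)^`().
Proof. by rewrite /derivY swapXYK. Qed.

Lemma derivY_eq0 p : derivY p = 0 -> p = ((swapXY p)`_0)^:P.
Proof.
move=> /(congr1 swapXY); rewrite swapXY_derivY rmorph0 => /(deriv_eq0_const A0).
by move/(congr1 swapXY); rewrite swapXYK swapXY_polyC.
Qed.

(* The equation a(x) b(y) p_x = c(x) d(y) p_y; x is the outer variable of p. *)
Definition separated a b c d p :=
  a^:P * b%:P * p^`() = c^:P * d%:P * derivY p.

(** This symmetry turns every statement about degrees in x into one about degrees in y. *)
Lemma separated_swapXY a b c d p :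
  separated a b c d p -> separated d c b a (swapXY p).
Proof.
move/(congr1 swapXY); rewrite !rmorphM /= !swapXY_polyC !swapXY_map_polyC.
rewrite swapXY_deriv swapXY_derivY /separated => e.
by rewrite (mulrC d^:P) -e (mulrC b^:P).
Qed.

(** * Degrees and leading terms in the separated equation *)

Lemma size_derivY_le p n : (size p <= n)%N -> (size (derivY p) <= n)%N.
Proof.
move=> pn; apply/leq_sizeP => j nj.
by rewrite coef_derivY nth_default ?deriv0 // (leq_trans pn).
Qed.

Lemma mul_map_polyC a b p : a^:P * b%:P * p = a^:P * (b *: p).
Proof. by rewrite -mulrA mul_polyC. Qed.

(** In x, the left side has degree exactly deg a + deg p - 1 in characteristic zero, while
    differentiation in y cannot raise the degree on the right above deg c + deg p. *)
Lemma size_separated a b c d p : a != 0 -> b != 0 -> p^`() != 0 ->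
  separated a b c d p -> (size a <= (size c).+1)%N.
Proof.
rewrite /separated !mul_map_polyC => a0 b0 px0 e.
have bpx0 : b *: p^`() != 0 by rewrite -mul_polyC mulf_neq0 ?polyC_eq0.
have szl : size (a^:P * (b *: p^`())) = (size a + (size p).-1).-1.
  rewrite size_mul ?map_polyC_eq0 // size_map_polyC.
  by rewrite size_scale // size_deriv_char0.
have szr : (size (c^:P * (d *: derivY p))%R <= (size c + size p).-1)%N.
  apply: leq_trans (size_polyMleq _ _) _; rewrite size_map_polyC.
  rewrite -!subn1 leq_sub2r // leq_add2l.
  exact: leq_trans (size_scale_leq _ _) (size_derivY_le (leqnn _)).
have a1 : (0 < size a)%N by rewrite size_poly_gt0.
have p1 : (0 < (size p).-1)%N by rewrite -size_deriv_char0 // size_poly_gt0.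
by rewrite -e szl in szr; lia.
Qed.

(* Compares the coefficients of x^(n + deg c). *)
Lemma separated_lead a b c d p n : (0 < size c)%N -> size a = (size c).+1 ->
  (size p <= n.+1)%N -> separated a b c d p ->
  lead_coef a *: (b * p`_n *+ n) = lead_coef c *: (d * (p`_n)^`()).
Proof.
rewrite /separated !mul_map_polyC => c0 ac; case: n => [|n] pn e.
  (* For n = 0, p does not involve x, so c d p_y = 0 with c nonzero, and both sides vanish. *)
  have px0 : p^`() = 0.
    apply/eqP; rewrite -size_poly_eq0 size_deriv_char0 // -leqn0 -subn1.
    by rewrite leq_subLR.
  move: e; rewrite px0 scaler0 mulr0 => /esym/eqP.
  rewrite mulf_eq0 map_polyC_eq0 -size_poly_eq0 eqn0Ngt c0 /= -(mul_polyC d).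
  rewrite mulf_eq0 polyC_eq0.
  case/orP => /eqP; first by move=> ->; rewrite mul0r mulr0n !scaler0.
  move/polyP/(_ 0); rewrite coef_derivY coef0 => ->.
  by rewrite mulr0 mulr0n !scaler0.
have := congr1 (fun q : {poly {poly K}} => q`_((size c).-1 + n.+1)) e.
have -> : (a^:P * (b *: p^`()))`_((size c).-1 + n.+1)
   = a^:P`_(size c) * (b *: p^`())`_n.
  rewrite -coefM_top ?size_map_polyC ?ac //; first by congr (_`__); lia.
  rewrite (leq_trans (size_scale_leq _ _)) // size_deriv_char0 // -subn1.
  by rewrite leq_subLR.
rewrite coefM_top ?size_map_polyC //; first last.
- by rewrite (leq_trans (size_scale_leq _ _)) // size_derivY_le.
- exact: leqSpred.
rewrite !coef_map /= !coefZ coef_derivY coef_deriv !mul_polyC.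
by rewrite !lead_coefE ac /= mulrnAr.
Qed.

Lemma deriv_neq0_size p : p^`() != 0 -> exists2 n, size p = n.+2 & p`_n.+1 != 0.
Proof.
rewrite -size_poly_gt0 size_deriv_char0 //.
case szp: (size p) => [|[|n]] // _; exists n => //.
by rewrite -[n.+1]/(n.+2.-1) -szp -lead_coefE lead_coef_eq0 -size_poly_eq0 szp.
Qed.

(** By [separated_lead] the leading coefficient t of p in x satisfies b t = d t' up to nonzero
    constants; the degrees in y are then compared. *)
Lemma size_separated_swap a b c d p :
  a != 0 -> b != 0 -> c != 0 -> p^`() != 0 ->
  size a = (size c).+1 -> separated a b c d p -> size d = (size b).+1.
Proof.
move=> a0 b0 c0 /deriv_neq0_size[n szp p0] ac e.
have cp : (0 < size c)%N by rewrite size_poly_gt0.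
have pn : (size p <= n.+2)%N by rewrite szp.
have h := separated_lead cp ac pn e.
have [t tE] : exists t : {poly K}, t = p`_n.+1 by eexists.
rewrite -tE in h p0.
have l0 : lead_coef a *: (b * t *+ n.+1) != 0.
  by rewrite scaler_eq0 negb_or lead_coef_eq0 a0 (mulrSn_eq0 A0) mulf_neq0.
have := l0; rewrite h scaler_eq0 mulf_eq0 !negb_or => /and3P[_ d0 dp0].
have := congr1 (fun q : {poly K} => size q) h.
rewrite !size_scale ?lead_coef_eq0 // -scaler_nat size_scale //.
rewrite !size_mul // size_deriv_char0 //.
move: dp0; rewrite -size_poly_gt0 size_deriv_char0 //.
by move: b0 d0; rewrite -!size_poly_gt0; move: (size b) (size d) (size t); lia.
Qed.

(* Here the leading coefficient of p in x is constant in y, and n lc(p) b is, up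
   to a constant, d times the leading coefficient of p_y, which is the derivative
   of a coefficient of p. *)
Lemma separated_additive a b c d p : a != 0 -> b != 0 -> c != 0 -> d != 0 ->
  p^`() != 0 -> (size a <= size c)%N -> separated a b c d p ->
  exists G, b = d * G^`().
Proof.
move=> a0 b0 c0 d0 px0 ac; rewrite /separated !mul_map_polyC => e.
have [n szp p0] := deriv_neq0_size px0.
have q0 : derivY p != 0.
  apply/eqP => q0; move: e; rewrite q0 scaler0 mulr0 => /eqP.
  by rewrite !(mulf_eq0, map_polyC_eq0, polyC_eq0, =^~ mul_polyC) (negPf a0)
    (negPf b0) (negPf px0).
have bpx0 : b *: p^`() != 0 by rewrite -mul_polyC mulf_neq0 ?polyC_eq0.
have dpy0 : d *: derivY p != 0 by rewrite -mul_polyC mulf_neq0 ?polyC_eq0.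
(* Here deg p_x = n, and the degrees in x give deg a + n = deg c + deg p_y. So deg p_y <= n, and the
   coefficient of x^(n+1) in p is constant in y. *)
have szq : (size (derivY p) <= n.+1)%N.
  have := congr1 (fun q : {poly {poly K}} => size q) e.
  rewrite !size_mul ?map_polyC_eq0 // !size_map_polyC !size_scale //.
  rewrite size_deriv_char0 // szp /= => sz.
  have : ((size a + n.+1).-1 <= (size c + n.+1).-1)%N by lia.
  rewrite sz; move: c0; rewrite -size_poly_gt0; case: (size c) => // m _.
  by rewrite /= leq_add2l.
have : (p`_n.+1)^`() = 0 by rewrite -coef_derivY nth_default.
move/(deriv_eq0_const K0) => pnE; set r := _`_0 in pnE.
have r0 : r != 0 by rewrite -polyC_eq0 -pnE.
have := congr1 (fun q : {poly {poly K}} => lead_coef q) e.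
rewrite !lead_coefM !lead_coefZ ![lead_coef _^:P]lead_coef_map /=.
rewrite [lead_coef p^`()]lead_coefE size_deriv_char0 // szp /= coef_deriv pnE.
rewrite [lead_coef (derivY p)]lead_coefE coef_derivY.
set t := p`__ => lc.
set s := lead_coef a * (r *+ n.+1).
have s0 : s != 0 by rewrite mulf_neq0 ?lead_coef_eq0 // (mulrSn_eq0 K0).
exists ((lead_coef c / s) *: t); rewrite derivZ -scalerAr.
apply: (scalerI s0); rewrite scalerA mulrCA divff // mulr1.
rewrite -[RHS]mul_polyC -[LHS]mul_polyC /s polyCM polyCMn; apply: etrans lc.
by rewrite -mulrA [_ * b]mulrC.
Qed.

Lemma derivs_eq0 p : p^`() = 0 -> derivY p = 0 -> exists r : K, p = r%:P%:P.
Proof.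
move=> /(deriv_eq0_const A0) -> ; rewrite derivY_polyC => /eqP.
rewrite polyC_eq0 => /eqP/(deriv_eq0_const K0) ->; by eexists.
Qed.

(* S = p_x / F' = p_y / G' is a polynomial which solves the same equation. *)
Lemma additive_structure F G p : F^`() != 0 -> G^`() != 0 ->
  separated 1 G^`() F^`() 1 p -> exists Q, p = Q^:P \Po (F^:P + G%:P).
Proof.
move=> F0 G0; have [n] := ubnP (size p); elim: n => // n IH in p *.
rewrite ltnS => pn; rewrite /separated rmorph1 mul1r mulr1 => e.
have [px0|px0] := eqVneq p^`() 0.
  move: e; rewrite px0 mulr0 => /esym/eqP.
  rewrite mulf_eq0 map_polyC_eq0 (negPf F0) /= => /eqP.
  case/(derivs_eq0 px0) => r ->; exists r%:P.
  by rewrite map_polyC /= comp_polyC.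
have lu : lead_coef F^`()^:P \is a GRing.unit.
  rewrite lead_coef_map /= poly_unitE size_polyC coefC /= unitfE.
  by rewrite lead_coef_eq0 F0.
have : (F^`()^:P %| p^`())%R.
  by rewrite -(dvdpZr _ _ G0) -mul_polyC e dvdp_mulr.
case/(Pdiv.IdomainUnit.dvdpP lu) => S; rewrite mulrC => pxE.
have pyE : derivY p = G^`()%:P * S.
  have F'0 : F^`()^:P != 0 by rewrite map_polyC_eq0.
  by apply: (mulfI F'0); rewrite -e pxE; ring.
(* The mixed derivatives of p agree, that is, G' S_x = F' S_y. *)
have eS : separated 1 G^`() F^`() 1 S.
  rewrite /separated rmorph1 mul1r mulr1.
  have := deriv_derivY p; rewrite pyE pxE derivM derivC mul0r add0r => ->.
  by rewrite derivYM derivY_map mul0r add0r.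
have szS : (size S < n)%N.
  apply: leq_trans pn; apply: leq_ltn_trans (lt_size_deriv _); last first.
    by apply: contraNneq px0 => ->; rewrite deriv0.
  have S0 : S != 0 by apply: contraNneq px0 => S0; rewrite pxE S0 mulr0.
  rewrite pxE size_mul ?map_polyC_eq0 // size_map_polyC.
  move: F0; rewrite -size_poly_gt0; case: (size _) => // m _.
  exact: leq_addl.
have [Q1 SE] := IH _ szS eS; have [Q QE] := antiderivative Q1.
have FGX : (F^:P + G%:P)^`() = F^`()^:P.
  by rewrite derivD deriv_map derivC addr0.
have FGY : derivY (F^:P + G%:P) = G^`()%:P.
  by rewrite raddfD /= derivY_map derivY_polyC add0r.
have [||r pE] := @derivs_eq0 (p - (Q^:P \Po (F^:P + G%:P))).
- by rewrite derivB deriv_comp deriv_map QE -SE FGX pxE mulrC subrr.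
- by rewrite raddfB /= derivY_comp QE -SE FGY pyE mulrC subrr.
exists (Q + r%:P).
by rewrite rmorphD /= map_polyC comp_polyD comp_polyC /= -pE addrC subrK.
Qed.
End CharZero.

(** * Product solutions *)

(* Solutions of the Euler-type equation u X' = k v X with deg u = deg v + 1: the
   degree of X is forced by k, so monic solutions are unique. *)
Section EulerEquation.
Variables (K : fieldType) (K0 : forall n, n.+1%:R != 0 :> K).
Variables (u v : {poly K}).
Hypotheses (v0 : v != 0) (uv : size u = (size v).+1).
Implicit Types (X Y : {poly K}) (k : K).

(** Both sides are compared in degree deg v + deg X, which equals deg u + deg X' when X is not
    constant. *)
Lemma euler_degree X k : X != 0 -> u * X^`() = k *: (v * X) ->
  lead_coef u * (size X).-1%:R = k * lead_coef v.
Proof.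
move=> X0 e.
have Xp : (0 < size X)%N by rewrite size_poly_gt0.
have := congr1 (fun q : {poly K} => q`_((size v).-1 + (size X).-1)) e.
rewrite coefZ (coefM_top (leqSpred (size v)) (leqSpred (size X))) -!lead_coefE.
have vp : (0 < size v)%N by rewrite size_poly_gt0.
case szX: (size X) Xp => [|[|m]] // _ /=.
  have -> : X^`() = 0.
    by apply/eqP; rewrite -size_poly_eq0 size_deriv_char0 // szX.
  rewrite mulr0 coef0 mulr0 => /esym/eqP.
  by rewrite mulrA mulf_eq0 lead_coef_eq0 (negPf X0) orbF => /eqP.
have -> : (u * X^`())`_((size v).-1 + m.+1) = u`_(size v) * X^`()`_m.
  rewrite -coefM_top ?uv // ?size_deriv_char0 ?szX //.
  by congr (_`__); move: vp; move: (size v); lia.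
rewrite coef_deriv -[X`_m.+1]/(X`_m.+2.-1) -szX -lead_coefE.
rewrite -[u`_(size v)]/(u`_(size v).+1.-1) -uv -lead_coefE => h.
rewrite -mulr_natr in h.
have lX : lead_coef X != 0 by rewrite lead_coef_eq0.
by apply: (mulIf lX); rewrite -[RHS]mulrA -h mulrAC mulrA.
Qed.

(** The difference of two solutions is again a solution; if nonzero it would have the degree of X,
    although the leading terms cancel. *)
Lemma euler_unique X Y k : X \is monic -> Y \is monic ->
  u * X^`() = k *: (v * X) -> u * Y^`() = k *: (v * Y) -> X = Y.
Proof.
move=> mX mY eX eY; apply/eqP; rewrite -subr_eq0; apply/negPn/negP => D0.
have lu : lead_coef u != 0 by rewrite lead_coef_eq0 -size_poly_eq0 uv.
have deg Z : Z != 0 -> u * Z^`() = k *: (v * Z) -> 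
    (size Z).-1%:R = k * lead_coef v / lead_coef u.
  by move=> Z0 /(euler_degree Z0) <-; rewrite mulrC mulKf.
have X0 := monic_neq0 mX; have Y0 := monic_neq0 mY.
have eD : u * (X - Y)^`() = k *: (v * (X - Y)).
  by rewrite derivB !mulrBr eX eY scalerBr.
have sXY : size X = size Y.
  have := etrans (deg _ X0 eX) (esym (deg _ Y0 eY)).
  move/(natr_inj_char0 K0) => h.
  by rewrite -[LHS]prednK ?size_poly_gt0 // h prednK ?size_poly_gt0.
have sXD : size (X - Y) = size X.
  have := etrans (deg _ D0 eD) (esym (deg _ X0 eX)).
  move/(natr_inj_char0 K0) => h.
  by rewrite -[LHS]prednK ?size_poly_gt0 // h prednK ?size_poly_gt0.
have := D0; rewrite -lead_coef_eq0 lead_coefE sXD coefB {2}sXY -!lead_coefE.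
by rewrite (monicP mX) (monicP mY) subrr eqxx.
Qed.

(** The equation prescribes the logarithmic derivative k v / u of X, so the constants k add up under
    products; [euler_div] is the same for quotients. *)
Lemma euler_exp X k n : u * X^`() = k *: (v * X) ->
  u * (X ^+ n)^`() = (n%:R * k) *: (v * X ^+ n).
Proof.
move=> e; elim: n => [|n IH].
  by rewrite expr0 derivC mulr0 mul0r scale0r.
rewrite exprS derivM mulrDr mulrA e (mulrCA u) IH -natr1 mulrDl mul1r scalerDl.
by rewrite -!mul_polyC; ring.
Qed.

Lemma euler_div X Y k l : X != 0 -> u * X^`() = k *: (v * X) ->
  u * (X * Y)^`() = l *: (v * (X * Y)) -> u * Y^`() = (l - k) *: (v * Y).
Proof.
move=> X0 eX; rewrite derivM mulrDr mulrA eX => e.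
apply: (mulfI X0); rewrite scalerBl -!mul_polyC in e *.
rewrite mulrBr; apply/eqP; rewrite -subr_eq0; apply/eqP.
apply: etrans (_ : (k%:P * (v * X) * Y + u * (X * Y^`()))
  - l%:P * (v * (X * Y)) = 0).
  by ring.
by rewrite e subrr.
Qed.

End EulerEquation.

Section MultiplicativeStructure.
Variables (K : fieldType) (K0 : forall n, n.+1%:R != 0 :> K).
Variables (a b c d : {poly K}).
Hypotheses (b0 : b != 0) (c0 : c != 0) (a1 : a \is monic) (c1 : c \is monic).
Hypotheses (ac : size a = (size c).+1) (db : size d = (size b).+1).
Implicit Types (X Y F G : {poly K}) (p q : {poly {poly K}}).

Let lc_d0 : lead_coef d != 0.
Proof. by rewrite lead_coef_eq0 -size_poly_eq0 db. Qed.

Let lc_b0 : lead_coef b != 0. Proof. by rewrite lead_coef_eq0. Qed.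

(* X(x) Y(y) solves the separated equation, with the separation constant
   normalized to the degree n of X. *)
Definition split_solution n X Y := [/\ X \is monic, Y \is monic,
  a * X^`() = n%:R *: (c * X) & d * Y^`() = n%:R *: (b * Y)].

Lemma split_solution_exp n X Y k : split_solution n X Y ->
  split_solution (k * n) (X ^+ k) (Y ^+ k).
Proof.
case=> mX mY eX eY; split; rewrite ?monic_exp // natrM; exact: euler_exp.
Qed.

Lemma split_solution_size n X Y : split_solution n X Y -> size X = n.+1.
Proof.
case=> mX _ eX _; have X0 := monic_neq0 mX.
have := euler_degree K0 c0 ac X0 eX.
rewrite (monicP a1) (monicP c1) mul1r mulr1 => /(natr_inj_char0 K0) <-.
by rewrite prednK ?size_poly_gt0.
Qed.

(** One subtraction of the Euclidean algorithm. F^n and X^f solve the same equation, so they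
    coincide by uniqueness; as f <= n, F^f divides X^f and hence F divides X. Likewise for G and
    Y. *)
Lemma split_solution_dvdp f n F X G Y : (0 < f <= n)%N ->
  split_solution f F G -> split_solution n X Y ->
  exists X' Y', [/\ X = F * X', Y = G * Y' & split_solution (n - f) X' Y'].
Proof.
case/andP=> f0 fn sF sX.
have [mF mG eF eG] := sF; have [mX mY eX eY] := sX.
have [mFn mGn eFn eGn] := split_solution_exp n sF.
have := split_solution_exp f sX; rewrite [(f * n)%N]mulnC => -[mXf mYf eXf eYf].
have dvd (Z T : {poly K}) : Z ^+ n = T ^+ f -> Z %| T.
  by move=> ZT; rewrite -(dvdp_pexp2r _ _ f0) -ZT dvdp_exp2l.
have /dvdpP[X' XE] := dvd _ _ (euler_unique K0 c0 ac mFn mXf eFn eXf).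
have /dvdpP[Y' YE] := dvd _ _ (euler_unique K0 b0 db mGn mYf eGn eYf).
exists X', Y'; rewrite mulrC in XE; rewrite mulrC in YE; split=> //.
move: mX mY eX eY; rewrite XE YE !monicMl // => mX' mY' eX eY.
by split; rewrite // natrB //;
  [apply: (euler_div _ eF eX)|apply: (euler_div _ eG eY)]; rewrite monic_neq0.
Qed.

(** Dividing by F and G lowers n by f; minimality excludes 0 < n < f, so the process ends at n = 0,
    where the only solution is 1. *)
Lemma split_solution_min f F G : (0 < f)%N -> split_solution f F G ->
  (forall n X Y, (0 < n)%N -> split_solution n X Y -> (f <= n)%N) ->
  forall n X Y, split_solution n X Y -> exists k, X = F ^+ k /\ Y = G ^+ k.
Proof.
move=> f0 sF minf; elim/ltn_ind => -[|n] IH X Y sX.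
  exists 0%N; rewrite !expr0; case: sX => mX mY eX eY.
  split; [apply: (euler_unique K0 c0 ac mX (monic1 _) eX)
         |apply: (euler_unique K0 b0 db mY (monic1 _) eY)];
  by rewrite -[1]/(1%:P) derivC mulr0 scale0r.
have fn := minf _ _ _ (ltn0Sn n) sX.
have [|X' [Y' [-> -> sX']]] := split_solution_dvdp _ sF sX; first by rewrite f0.
have [|k [-> ->]] := IH _ _ _ _ sX'; first by lia.
by exists k.+1; rewrite !exprS.
Qed.

(* The factors are the leading coefficients of p with respect to y and to x; the
   degree bounds between them and p are equalities. *)
Lemma separated_split p : p^`() != 0 -> separated a b c d p ->
  exists n X Y (r : K),
    [/\ size p = n.+2, split_solution n.+1 X Y & p`_n.+1 = r *: Y].
Proof.
move=> px0 e; have [n szp t0] := deriv_neq0_size K0 px0.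
have cp : (0 < size c)%N by rewrite size_poly_gt0.
have bp : (0 < size b)%N by rewrite size_poly_gt0.
have := separated_lead K0 cp ac (eq_leq szp) e.
have [t tE] : exists t : {poly K}, t = p`_n.+1 by eexists.
rewrite -tE in t0 *; rewrite (monicP a1) (monicP c1) !scale1r => et.
have {}et : d * t^`() = n.+1%:R *: (b * t) by rewrite -et scaler_nat.
have degt := euler_degree K0 b0 db t0 et.
have p0 : p != 0 by apply: contraNneq px0 => ->; rewrite deriv0.
have [m szq] : exists m, size (swapXY p) = m.+1.
  exists (size (swapXY p)).-1; rewrite prednK // size_poly_gt0.
  by rewrite swapXY_eq0.
have := separated_lead K0 bp db (eq_leq szq) (separated_swapXY e).
have [s sE] : exists s : {poly K}, s = (swapXY p)`_m by eexists.
rewrite -sE => es.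
have s0 : s != 0.
  rewrite sE -[m]/(m.+1.-1) -szq -lead_coefE lead_coef_eq0 -size_poly_eq0.
  by rewrite szq.
have {}es : a * s^`() = (lead_coef d * m%:R / lead_coef b) *: (c * s).
  apply: (scalerI lc_b0); rewrite -es scalerA mulrCA divff // mulr1.
  by rewrite -scalerA scaler_nat.
have degs := euler_degree K0 c0 ac s0 es.
rewrite (monicP a1) (monicP c1) mul1r mulr1 in degs.
have szt : (size t <= m.+1)%N by rewrite -szq -sizeYE tE max_size_coefXY.
have szs : (size s <= n.+2)%N.
  by have := max_size_coefXY (swapXY p) m; rewrite sizeYE swapXYK szp sE.
(* With deg p = n + 1 in x and m in y, the Euler equations give lc(d) deg t = (n + 1) lc(b) and deg
   s = lc(d) m / lc(b). The bounds deg s <= n + 1 and deg t <= m then force deg s = n + 1, since deg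
   t > 0. *)
have degE : ((size s).-1 * (size t).-1 = m * n.+1)%N.
  apply: (natr_inj_char0 K0); rewrite /= !natrM degs; apply: (mulfI lc_d0).
  by rewrite mulrCA degt -mulrA; field.
have tp : (0 < (size t).-1)%N.
  rewrite lt0n; apply/eqP => t1; move: degt; rewrite t1 mulr0 => /esym/eqP.
  by rewrite mulf_eq0 (negPf (K0 n)) (negPf lc_b0).
have sn : (size s).-1 = n.+1.
  have : ((size t).-1 <= m)%N by rewrite -subn1 leq_subLR.
  have : ((size s).-1 <= n.+1)%N by rewrite -subn1 leq_subLR.
  move: (size s).-1 (size t).-1 tp degE => i j j0 E i_le j_le.
  by clear -E i_le j_le j0; nia.
rewrite -degs sn in es.
exists n, ((lead_coef s)^-1 *: s), ((lead_coef t)^-1 *: t), (lead_coef t).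
have lt0 : lead_coef t != 0 by rewrite lead_coef_eq0.
have ls0 : lead_coef s != 0 by rewrite lead_coef_eq0.
split=> //; last by rewrite scalerA divff // scale1r.
split; rewrite ?monicE ?lead_coefZ ?mulVf // derivZ -!scalerAr ?es ?et;
  by rewrite !scalerA mulrC.
Qed.

(** Both sides are n c(x) X(x) b(y) Y(y). *)
Lemma separated_split_solution n X Y : split_solution n X Y ->
  separated a b c d (X^:P * Y%:P).
Proof.
case=> _ _ eX eY; rewrite /separated derivM derivC mulr0 addr0 deriv_map.
rewrite derivYM derivY_map mul0r add0r derivY_polyC.
have {}eX : a^:P * X^`()^:P = n%:R * (c^:P * X^:P).
  by rewrite -!rmorphM eX /= !scaler_nat rmorphMn /= mulr_natl.
have {}eY : d%:P * Y^`()%:P = n%:R * (b%:P * Y%:P).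
  by rewrite -!rmorphM eY /= !scaler_nat rmorphMn /= mulr_natl.
transitivity ((a^:P * X^`()^:P) * (b%:P * Y%:P)); first by ring.
rewrite eX; transitivity (c^:P * X^:P * (d%:P * Y^`()%:P)); last by ring.
by rewrite eY; ring.
Qed.

(** A pair F, G of least positive degree generates all product solutions. The leading coefficient of
    p in x is r Y for a solution X Y = (F G)^k, and subtracting r (F G)^k keeps the equation and
    lowers the degree in x. *)
Lemma multiplicative_structure p : p^`() != 0 -> separated a b c d p ->
  exists Q F G, p = Q^:P \Po (F^:P * G%:P).
Proof.
move=> px0 ep.
have exf : exists n, `[< (0 < n)%N /\ exists X Y, split_solution n X Y >].
  have [n [X [Y [r [_ sXY _]]]]] := separated_split px0 ep.
  by exists n.+1; apply/asboolP; split=> //; exists X, Y.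
case: (ex_minnP exf) => f /asboolP[f0 [F [G sF]]] minf.
have {}minf n X Y : (0 < n)%N -> split_solution n X Y -> (f <= n)%N.
  by move=> n0 sX; apply: minf; apply/asboolP; split=> //; exists X, Y.
(* F and G are fixed before the induction, so that they serve every remainder. *)
suff [Q ->] : exists Q, p = Q^:P \Po (F^:P * G%:P) by exists Q, F, G.
have [N] := ubnP (size p); elim: N p {px0 exf} ep => // N IH p ep.
rewrite ltnS => pN.
have [px0|px0] := eqVneq p^`() 0.
  move: (ep); rewrite /separated px0 mulr0 => /esym/eqP.
  rewrite !mulf_eq0 map_polyC_eq0 polyC_eq0 (negPf c0) -(lead_coef_eq0 d).
  rewrite (negPf lc_d0) /= => /eqP.
  case/(derivs_eq0 K0 px0) => r ->; exists r%:P.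
  by rewrite map_polyC /= comp_polyC.
have [n [X [Y [r [szp sX pn]]]]] := separated_split px0 ep.
have [k [XE YE]] := split_solution_min f0 sF minf sX.
have szX := split_solution_size sX.
set h := r%:P%:P * (X^:P * Y%:P).
have eh : separated a b c d (p - h).
  have := separated_split_solution sX; move: ep; rewrite /separated => ep eX.
  rewrite derivB raddfB /= !mulrBr ep; congr (_ - _).
  rewrite /h derivM derivC mul0r add0r derivYM derivY_polyC derivC mul0r add0r.
  by rewrite mulrCA eX mulrCA.
have szh : (size (p - h)%R <= n.+1)%N.
  apply/leq_sizeP => j; rewrite leq_eqVlt => /orP[/eqP<-|nj].
    rewrite coefB pn /h coefCM coefMC coef_map /=.
    have -> : X`_n.+1 = 1.
      have [/monicP mX _ _ _] := sX.
      by rewrite -[RHS]mX lead_coefE szX.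
    by rewrite mul1r mul_polyC subrr.
  rewrite coefB /h coefCM coefMC coef_map /= [p`_j]nth_default ?szp //.
  by rewrite [X`_j]nth_default ?szX // mul0r mulr0 subr0.
have [|Q QE] := IH _ eh.
  by apply: leq_ltn_trans szh _; rewrite -szp.
exists (Q + r *: 'X^k).
rewrite rmorphD /= comp_polyD -QE map_polyZ /= comp_polyZ map_polyXn.
rewrite comp_Xn_poly exprMn /h XE YE -mul_polyC -rmorphXn /= -rmorphXn /=.
by rewrite subrK.
Qed.

End MultiplicativeStructure.

(** * The Jacobian identity *)

Section MmapTheory.
Variables (n : nat) (R S : comNzRingType).
Implicit Types p q : {mpoly R[n]}.

Lemma eq_mmap (f g : R -> S) (h k : 'I_n -> S) p :
  f =1 g -> h =1 k -> mmap f h p = mmap g k p.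
Proof.
by move=> fg hk; apply: eq_bigr => m _; rewrite fg (mmap1_eq _ hk).
Qed.

Lemma rmorph_mmap (T : comNzRingType) (phi : {rmorphism S -> T}) (f : R -> S)
    (h : 'I_n -> S) p :
  phi (mmap f h p) = mmap (phi \o f) (phi \o h) p.
Proof.
rewrite rmorph_sum; apply: eq_bigr => m _; rewrite rmorphM rmorph_prod.
by congr (_ * _); apply: eq_bigr => i _; rewrite rmorphXn.
Qed.

Lemma mmap_id p : mmap (@mpolyC n R) (fun i => 'X_i) p = p.
Proof.
rewrite [RHS]mpolyE; apply: eq_bigr => m _.
by rewrite mmap1_id mul_mpolyC.
Qed.

(** The chain rule, checked on constants and variables and propagated through sums and products. The
    derivation is a bare function with its laws as hypotheses, so this covers [mderiv], [deriv] and
    [derivY]. *)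
Lemma mmap_derivation (f : {rmorphism R -> S}) (h : 'I_n -> S)
    (der : S -> S) p :
  (forall x y, der (x + y) = der x + der y) ->
  (forall x y, der (x * y) = der x * y + x * der y) ->
  (forall r, der (f r) = 0) ->
  der (mmap f h p) = \sum_(i < n) mmap f h p^`M(i) * der (h i).
Proof.
move=> derD derM derf; pose ok q := der (mmap f h q)
   = \sum_(i < n) mmap f h q^`M(i) * der (h i).
rewrite -/(ok p).
have okC r : ok r%:MP.
  by rewrite /ok mmapC derf big1 // => i _; rewrite mderivC mmap0 mul0r.
have okD q1 q2 : ok q1 -> ok q2 -> ok (q1 + q2).
  rewrite /ok mmapD derD => -> ->; rewrite -big_split /=.
  by apply: eq_bigr => i _; rewrite mderivD mmapD mulrDl.
have okM q1 q2 : ok q1 -> ok q2 -> ok (q1 * q2).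
  rewrite /ok rmorphM derM => -> ->; rewrite mulr_suml mulr_sumr -big_split /=.
  by apply: eq_bigr => i _; rewrite mderivM mmapD !rmorphM /=; ring.
have okX i : ok 'X_i.
  rewrite /ok mmapX mmap1U (bigD1 i) //= big1 => [|j ji].
    rewrite mderivX mnm1E eqxx scale1r -{1}[U_(i)%MM]add0m addmK mmapX mmap11.
    by rewrite mul1r addr0.
  by rewrite mderivX mnm1E eq_sym (negPf ji) scale0r mmap0 mul0r.
have okXm m : ok 'X_[m].
  rewrite mpolyXE_id; elim/big_ind: _ => [|q1 q2|i _]; last 1 first.
  - by elim: (m i) => [|k IH]; [exact: (okC 1) | rewrite exprS; apply: okM].
  - exact: (okC 1).
  - exact: okM.
elim/mpolyind: p => [|r m q _ _ okq]; first by rewrite -mpolyC0.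
by apply: okD => //; rewrite -mul_mpolyC; apply: okM.
Qed.

End MmapTheory.

(** * Multivariate polynomials in characteristic zero *)

Section CharZeroMpoly.
Variables (R : idomainType) (R0 : forall n, n.+1%:R != 0 :> R).

Lemma natr_mpoly_char0 n k : k.+1%:R != 0 :> {mpoly R[n]}.
Proof. by rewrite -mpolyC_nat mpolyC_eq0. Qed.

(** Induction on n: U reads p as a polynomial in the variable 0 over the other variables; its values
    at the naturals vanish by induction, so it has infinitely many roots. *)
Lemma mpoly_vanish n (p : {mpoly R[n]}) :
  (forall v : 'I_n -> nat, p.@[fun i => (v i)%:R] = 0) -> p = 0.
Proof.
elim: n => [|n IH] in p *.
  move=> /(_ (fun=> 0%N)).
  have pE : p = (p@_0)%:MP.
    apply/mpolyP => m; rewrite mcoeffC (_ : m = 0%MM) ?eqxx ?mulr1 //.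
    by apply/mnmP => -[].
  by rewrite pE mevalC => ->; rewrite mpolyC0.
pose h (i : 'I_n.+1) : {poly {mpoly R[n]}} :=
  if unlift ord0 i is Some j then ('X_j)%:P else 'X.
pose U := mmap (polyC \o @mpolyC n R) h.
move=> p0; suff Up0 : U p = 0.
  (* W followed by evaluation at the variable 0 undoes U. *)
  pose W := mmap (@mpolyC n.+1 R) (fun j : 'I_n => 'X_(lift ord0 j)).
  have : (map_poly W (U p)).['X_ord0] = p.
    rewrite /U rmorph_mmap -[LHS]/(horner_eval 'X_ord0 _) rmorph_mmap.
    rewrite -[RHS]mmap_id; apply: eq_mmap => [r|i] /=.
      by rewrite map_polyC /= horner_evalE hornerC /W mmapC.
    rewrite /h; case: unliftP => [j ->|->].
      by rewrite map_polyC /= horner_evalE hornerC /W mmapX mmap1U.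
    by rewrite map_polyX horner_evalE hornerX.
  by rewrite Up0 map_poly0 horner0.
apply: (vanish_on_infinite (natr_inj_char0 (natr_mpoly_char0 n))) => y.
apply: IH => v; rewrite -[_.[_]]/(horner_eval _ _) !rmorph_mmap.
pose w (i : 'I_n.+1) := if unlift ord0 i is Some j then v j else y.
rewrite -(p0 w); apply: eq_mmap => [r|i] /=.
  by rewrite horner_evalE hornerC mevalC.
rewrite /h /w horner_evalE; case: unliftP => [j _|_].
  by rewrite hornerC mevalXU.
by rewrite hornerX -mpolyC_nat mevalC.
Qed.

Lemma mderiv_eq0_const n (p : {mpoly R[n]}) :
  (forall i, p^`M(i) = 0) -> p = (p@_0)%:MP.
Proof.
move=> dp; apply/mpolyP => m; rewrite mcoeffC eq_sym.
have [->|m0] := eqVneq; first by rewrite mulr1.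
have [i mi] : exists i, (0 < m i)%N.
  apply: contrapT => h; case/eqP: m0; apply/mnmP => i; rewrite mnm0E.
  by have [//|mi] := posnP (m i); case: h; exists i.
have := mcoeff_mderiv i p (m - U_(i)); rewrite dp mcoeff0 submK; last first.
  by apply/mnm_lepP => j; rewrite mnm1E; case: eqP => // <-.
by move/esym/eqP; rewrite (mulrSn_eq0 R0) mulr0 => /eqP.
Qed.

Lemma msize_mderiv n i (p : {mpoly R[n]}) : p^`M(i) != 0 ->
  (msize p^`M(i) < msize p)%N.
Proof.
move=> dp0; rewrite -(mlead_deg dp0) -ltnS.
have := mlead_supp dp0; rewrite mcoeff_msupp mcoeff_mderiv => h.
have : (mlead p^`M(i) + U_(i))%MM \in msupp p.
  by rewrite mcoeff_msupp; apply: contraNneq h => ->; rewrite mul0rn.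
by move/msize_mdeg_lt; rewrite mdegD mdeg1 addn1.
Qed.

(* Witnessed by a relation of minimal degree. *)
Lemma minimal_relation n (S : idomainType) (f : {rmorphism R -> S})
    (g : 'I_n -> S) (p : {mpoly R[n]}) : injective f ->
  p != 0 -> mmap f g p = 0 ->
  exists q : {mpoly R[n]}, mmap f g q = 0 /\ exists i, mmap f g q^`M(i) != 0.
Proof.
move=> finj; have [N] := ubnP (msize p); elim: N p => // N IH p.
rewrite ltnS => pN p0 pg.
have [[i dpi]|nex] := pselect (exists i, mmap f g p^`M(i) != 0).
  by exists p; split=> //; exists i.
have dg i : mmap f g p^`M(i) = 0.
  by apply/eqP/negPn/negP => h; apply: nex; exists i.
(* All partial derivatives vanish at g, so a nonzero one is a smaller relation; if there is none, p
   is a nonzero constant, against the injectivity of f. *)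
have [[i dpi]|nex'] := pselect (exists i, p^`M(i) != 0).
  apply: (IH _ _ dpi (dg i)).
  exact: leq_trans (msize_mderiv dpi) pN.
have pE : p = (p@_0)%:MP.
  apply: mderiv_eq0_const => i.
  by apply/eqP/negPn/negP => h; apply: nex'; exists i.
move: (p@_0) pE => r pE; move: p0 pg; rewrite pE mmapC mpolyC_eq0.
by rewrite -(rmorph0 f) => r0 /finj rE; rewrite rE eqxx in r0.
Qed.

End CharZeroMpoly.

Lemma sum_ord4 (V : nmodType) (F : 'I_4 -> V) : \sum_(i < 4) F i =
  F (inord 0) + F (inord 1) + F (inord 2) + F (inord 3).
Proof.
rewrite !big_ord_recl big_ord0 addr0 !addrA.
by congr (F _ + F _ + F _ + F _); apply/val_inj; rewrite /= inordK.
Qed.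

Lemma rmorph_mul4 (D T : comNzRingType) (phi : {rmorphism D -> T})
    (x1 x2 x3 x4 y1 y2 y3 y4 : D) : x1 * x2 * x3 * x4 = y1 * y2 * y3 * y4 ->
  phi x1 * phi x2 * phi x3 * phi x4 = phi y1 * phi y2 * phi y3 * phi y4.
Proof. by rewrite -!rmorphM => ->. Qed.

Section Jacobian.
Variables (K : fieldType) (L : closedFieldType) (iota : {rmorphism K -> L}).
Hypothesis K0 : forall n, n.+1%:R != 0 :> K.
Implicit Types (P q : {mpoly K[2]}) (v : 'I_4 -> K).

Let L0 n : n.+1%:R != 0 :> L.
Proof. by rewrite -(rmorph_nat iota) fmorph_eq0. Qed.

Let X2 (S : Type) (x y : S) (i : 'I_2) : S := if i == ord0 then x else y.

Let eval2E q x y : eval2 q x y = mmap idfun (X2 x y) q.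
Proof.
by apply: eq_mmap => // -[[|[|i]] lti] //; rewrite (tnth_nth x).
Qed.

(** The indeterminates will stand for a, b, c, d. Coefficients are sent to L because the relation
    given by non-density lives there. *)
Definition generic_value q (i j : 'I_4) : {mpoly L[4]} :=
  mmap (@mpolyC 4 L \o iota)
    (fun k : 'I_2 => if k == ord0 then 'X_i else 'X_j) q.

Lemma meval_generic_value q i j v :
  (generic_value q i j).@[iota \o v] = iota (eval2 q (v i) (v j)).
Proof.
rewrite eval2E rmorph_mmap /generic_value rmorph_mmap.
apply: eq_mmap => [r|k] /=; first by rewrite mevalC.
by rewrite /X2; case: ifP => _; rewrite mevalXU.
Qed.

Lemma eval2_neq0 q : q != 0 -> exists m n : nat, eval2 q m%:R n%:R != 0.
Proof.
move=> q0; apply: contrapT => h; case/eqP: q0.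
apply: (mpoly_vanish K0) => v; apply/eqP/negPn/negP => vq; apply: h.
exists (v ord0), (v ord_max); apply: contraNN vq; rewrite eval2E => /eqP <-.
apply/eqP/eq_mmap => // i; rewrite /X2; case: eqP => [->//|/eqP i0].
by congr (v _)%:R; apply/val_inj; move: i i0 => [[|[|i]] lti].
Qed.

Lemma generic_value_neq0 q i j : i != j -> q != 0 -> generic_value q i j != 0.
Proof.
move=> ij /eval2_neq0[m [n qmn]]; apply: contraNneq qmn => q0.
pose v (k : 'I_4) : K := if k == i then m%:R else n%:R.
have := meval_generic_value q i j v.
rewrite q0 meval0 /v eqxx eq_sym (negPf ij).
by move/esym/eqP; rewrite fmorph_eq0.
Qed.

Lemma mderivXU (i k : 'I_4) : ('X_i : {mpoly L[4]})^`M(k) = (i == k)%:R.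
Proof.
rewrite mderivX mnm1E; case: eqP => [->|_]; last by rewrite scale0r.
by rewrite scale1r -{1}[U_(k)%MM]add0m addmK mpolyX0.
Qed.

Lemma mderiv_generic_value q i j k : (generic_value q i j)^`M(k) =
  generic_value q^`M(ord0) i j * (i == k)%:R
  + generic_value q^`M(ord_max) i j * (j == k)%:R.
Proof.
have -> : ord_max = lift ord0 ord0 :> 'I_2 by apply/val_inj.
rewrite /generic_value.
rewrite (mmap_derivation _ _ (mderivD k) (mderivM k)); last first.
  by move=> r; rewrite /= mderivC.
by rewrite big_ord_recl big_ord1 !mderivXU.
Qed.

(* The zero summands are the zero entries of the Jacobian matrix. *)
Lemma cross_ratio_relation (D : idomainType)
    (r0 r1 r2 r3 a02 a03 a12 a13 b02 b03 b12 b13 : D) :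
  r0 * a02 + r1 * a03 + r2 * 0 + r3 * 0 = 0 ->
  r0 * 0 + r1 * 0 + r2 * a12 + r3 * a13 = 0 ->
  r0 * b02 + r1 * 0 + r2 * b12 + r3 * 0 = 0 ->
  r0 * 0 + r1 * b03 + r2 * 0 + r3 * b13 = 0 ->
  a03 != 0 -> a13 != 0 -> b12 != 0 -> b13 != 0 ->
  a02 != 0 -> b03 != 0 -> b02 != 0 ->
  [|| r0 != 0, r1 != 0, r2 != 0 | r3 != 0] ->
  a02 * b03 * b12 * a13 = a03 * a12 * b02 * b13.
Proof.
rewrite !mulr0 !addr0 !add0r => e0 e1 e2 e3.
move=> a03_0 a13_0 b12_0 b13_0 a02_0 b03_0 b02_0 rn0.
(* The four equations link the r in a cycle, so a zero passes from one to its neighbour through a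
   nonzero coefficient. *)
have step x y s t : x * s + y * t = 0 -> t != 0 -> x = 0 -> y = 0 :> D.
  move=> e t0 x0; move: e; rewrite x0 mul0r add0r => /eqP.
  by rewrite mulf_eq0 (negPf t0) orbF => /eqP.
have r0_0 : r0 != 0.
  apply: contraTneq rn0 => r00.
  have r10 := step _ _ _ _ e0 a03_0 r00; have r20 := step _ _ _ _ e2 b12_0 r00.
  by have r30 := step _ _ _ _ e3 b13_0 r10; rewrite r00 r10 r20 r30 eqxx.
have r1_0 : r1 != 0.
  apply: contraNneq r0_0 => r10; rewrite addrC in e0.
  by rewrite (step _ _ _ _ e0 a02_0 r10).
have r2_0 : r2 != 0.
  apply: contraNneq r0_0 => r20; rewrite addrC in e2.
  by rewrite (step _ _ _ _ e2 b02_0 r20).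
have r3_0 : r3 != 0.
  apply: contraNneq r1_0 => r30; rewrite addrC in e3.
  by rewrite (step _ _ _ _ e3 b03_0 r30).
apply: (mulfI (mulf_neq0 (mulf_neq0 r0_0 r1_0) (mulf_neq0 r2_0 r3_0))).
(* The differences are r2 b12 and r1 b03, written so that the last two equations can be
   substituted. *)
transitivity ((r0 * a02) * (r3 * a13) * ((r0 * b02 + r2 * b12) - r0 * b02)
  * ((r1 * b03 + r3 * b13) - r3 * b13)); first by ring.
move/eqP: e0; rewrite addr_eq0 => /eqP ->.
move/eqP: e1; rewrite addrC addr_eq0 => /eqP ->.
by rewrite e2 e3; ring.
Qed.

(** The r form a nonzero vector in the kernel of the Jacobian matrix, in which each variable affects
    only two of the four values. The resulting identity over L is specialized to points of K and
    pulled back along the injective [iota]. *)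
Lemma generic_jacobian P (i0 i1 i2 i3 : 'I_4) (r0 r1 r2 r3 : {mpoly L[4]}) :
  uniq [:: i0; i1; i2; i3] -> P^`M(ord0) != 0 -> P^`M(ord_max) != 0 ->
  (forall k,
    r0 * (generic_value P i0 i2)^`M(k) + r1 * (generic_value P i0 i3)^`M(k) +
    r2 * (generic_value P i1 i2)^`M(k) + r3 * (generic_value P i1 i3)^`M(k) = 0) ->
  [|| r0 != 0, r1 != 0, r2 != 0 | r3 != 0] ->
  let Px := eval2 P^`M(ord0) in let Py := eval2 P^`M(ord_max) in forall v,
  Px (v i0) (v i2) * Py (v i0) (v i3) * Py (v i1) (v i2) * Px (v i1) (v i3) =
  Px (v i0) (v i3) * Px (v i1) (v i2) * Py (v i0) (v i2) * Py (v i1) (v i3).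
Proof.
rewrite /= !inE !negb_or -!andbA andbT.
case/and5P=> n01 n02 n03 n12 /andP[n13 n23].
move=> Px0 Py0 relE rn0 v.
pose A := generic_value P^`M(ord0); pose B := generic_value P^`M(ord_max).
have dA k l : k != l -> (generic_value P k l)^`M(k) = A k l.
  move=> kl; rewrite mderiv_generic_value eqxx eq_sym (negPf kl).
  by rewrite mulr1 mulr0 addr0.
have dB k l : k != l -> (generic_value P k l)^`M(l) = B k l.
  move=> kl; rewrite mderiv_generic_value eqxx (negPf kl).
  by rewrite mulr1 mulr0 add0r.
have dO k l m : k != m -> l != m -> (generic_value P k l)^`M(m) = 0.
  move=> km lm; rewrite mderiv_generic_value (negPf km) (negPf lm).
  by rewrite !mulr0 addr0.
have A0 k l : k != l -> A k l != 0 by move=> kl; apply: generic_value_neq0.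
have B0 k l : k != l -> B k l != 0 by move=> kl; apply: generic_value_neq0.
have n10 : i1 != i0 by rewrite eq_sym.
have n20 : i2 != i0 by rewrite eq_sym.
have n30 : i3 != i0 by rewrite eq_sym.
have n21 : i2 != i1 by rewrite eq_sym.
have n31 : i3 != i1 by rewrite eq_sym.
have n32 : i3 != i2 by rewrite eq_sym.
have e0 := relE i0.
rewrite (dA _ _ n02) (dA _ _ n03) (dO _ _ _ n10 n20) (dO _ _ _ n10 n30) in e0.
have e1 := relE i1.
rewrite (dO _ _ _ n01 n21) (dO _ _ _ n01 n31) (dA _ _ n12) (dA _ _ n13) in e1.
have e2 := relE i2.
rewrite (dB _ _ n02) (dO _ _ _ n02 n32) (dB _ _ n12) (dO _ _ _ n12 n32) in e2.
have e3 := relE i3.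
rewrite (dO _ _ _ n03 n23) (dB _ _ n03) (dO _ _ _ n13 n23) (dB _ _ n13) in e3.
have := cross_ratio_relation e0 e1 e2 e3 (A0 _ _ n03) (A0 _ _ n13) (B0 _ _ n12)
  (B0 _ _ n13) (A0 _ _ n02) (B0 _ _ n03) (B0 _ _ n02) rn0.
move/(rmorph_mul4 (meval (iota \o v))) => h.
by apply: (fmorph_inj iota); rewrite !rmorphM -!meval_generic_value.
Qed.

Lemma quad_jacobian P : ~ zariski_dense (quad_values iota P) ->
  P^`M(ord0) != 0 -> P^`M(ord_max) != 0 -> forall x y z w : K,
  let Px := eval2 P^`M(ord0) in let Py := eval2 P^`M(ord_max) in
  Px x z * Py x w * Py y z * Px y w = Px x w * Px y z * Py x z * Py y w.
Proof.
move=> nd Px0 Py0.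
(* If only 0 vanished on the values, every closed set containing them would be the whole space. *)
have [R [R0 Rv]] : exists R : {mpoly L[4]}, R != 0 /\
    forall v : 4.-tuple L, quad_values iota P v -> R.@[tnth v] = 0.
  apply: contrapT => h; apply: nd => Z [S ->] sub.
  apply/seteqP; split=> // v _ p Sp.
  have [->|p0] := eqVneq p 0; first by rewrite meval0.
  by case: h; exists p; split=> // u /sub; apply.
pose i0 : 'I_4 := inord 0; pose i1 : 'I_4 := inord 1.
pose i2 : 'I_4 := inord 2; pose i3 : 'I_4 := inord 3.
have uniq_i : uniq [:: i0; i1; i2; i3].
  by rewrite -(map_inj_uniq val_inj) /= !inordK.
pose g := tnth [tuple generic_value P i0 i2; generic_value P i0 i3;
                      generic_value P i1 i2; generic_value P i1 i3].
(* The relation holds at all natural points, since these come from K; hence it holds identically. *)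
have Rg : mmap (@mpolyC 4 L) g R = 0.
  apply: (mpoly_vanish L0) => v; rewrite rmorph_mmap.
  pose w (i : 'I_4) : K := (v i)%:R.
  rewrite -[RHS](Rv [tuple
     iota (eval2 P (w i0) (w i2)); iota (eval2 P (w i0) (w i3));
     iota (eval2 P (w i1) (w i2)); iota (eval2 P (w i1) (w i3))]); last first.
    by exists (w i0), (w i1), (w i2), (w i3).
  apply: eq_mmap => [r|k] /=; first by rewrite mevalC.
  have wE : (fun i => (v i)%:R) =1 iota \o w by move=> i; rewrite /= rmorph_nat.
  rewrite (meval_eq _ wE) /g.
  by case: k => -[|[|[|[|k]]]] k4 //;
    rewrite !(tnth_nth 0) /= meval_generic_value.
have Cinj : injective (@mpolyC 4 L).
  by apply: (can_inj (g := fun q : {mpoly L[4]} => q@_0)) => x; rewrite mpolyCK.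
have [Q [Qg [i dQ]]] := minimal_relation L0 Cinj R0 Rg.
(* The chain rule applied to Q(g) = 0: the partial derivatives of Q at g annihilate the Jacobian
   matrix. *)
have rel k : \sum_(i < 4) mmap (@mpolyC 4 L) g Q^`M(i) * (g i)^`M(k) = 0.
  rewrite -(mmap_derivation _ _ (mderivD k) (mderivM k)) ?Qg ?mderiv0 //.
  exact: mderivC.
pose r k := mmap (@mpolyC 4 L) g Q^`M(inord k).
have relE k :
    r 0%N * (generic_value P i0 i2)^`M(k) + r 1%N * (generic_value P i0 i3)^`M(k) +
    r 2%N * (generic_value P i1 i2)^`M(k) + r 3%N * (generic_value P i1 i3)^`M(k)
    = 0.
  rewrite -(rel k) sum_ord4 /r.
  by congr (_ * mderiv k _ + _ * mderiv k _ + _ * mderiv k _ + _ * mderiv k _);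
    rewrite /g (tnth_nth 0) /= inordK.
have rn0 : [|| r 0%N != 0, r 1%N != 0, r 2%N != 0 | r 3%N != 0].
  have some4 (b : nat -> bool) k :
      (k < 4)%N -> b k -> [|| b 0, b 1, b 2 | b 3]%N.
    by case: k => [|[|[|[|k]]]] //= _ ->; rewrite ?orbT.
  apply: (some4 (fun k => r k != 0) i (ltn_ord i)).
  by rewrite /r inord_val.
move=> x y z w.
have := generic_jacobian uniq_i Px0 Py0 relE rn0 (tnth [tuple x; y; z; w]).
by rewrite /= !(tnth_nth 0) /= !inordK.
Qed.
End Jacobian.

(** * Structure of solutions *)

Section Structure.
Variables (K : fieldType) (K0 : forall n, n.+1%:R != 0 :> K).
Implicit Types (a b c d F G Q : {poly K}) (p : {poly {poly K}}).

Lemma separated_structure a b c d p :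
  a != 0 -> b != 0 -> c != 0 -> d != 0 -> p^`() != 0 -> derivY p != 0 ->
  separated a b c d p ->
  (exists Q F G, p = Q^:P \Po (F^:P + G%:P)) \/
  (exists Q F G, p = Q^:P \Po (F^:P * G%:P)).
Proof.
move=> a0 b0 c0 d0 px0 py0 e.
have e' := separated_swapXY e.
have px0' : (swapXY p)^`() != 0 by rewrite -swapXY_derivY swapXY_eq0.
have [ac|ac] := eqVneq (size a) (size c).+1.
  right; have db := size_separated_swap K0 a0 b0 c0 px0 ac e.
  have la0 : lead_coef a != 0 by rewrite lead_coef_eq0.
  have lc0 : lead_coef c != 0 by rewrite lead_coef_eq0.
  (* Scalars are moved from a to b and from c to d, which makes a and c monic without changing the
     equation. *)
  apply: (@multiplicative_structure _ K0 ((lead_coef a)^-1 *: a)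
    (lead_coef a *: b) ((lead_coef c)^-1 *: c) (lead_coef c *: d)) => //.
  - by rewrite scaler_eq0 negb_or la0.
  - by rewrite scaler_eq0 negb_or invr_eq0 lc0.
  - by rewrite monicE lead_coefZ mulVf.
  - by rewrite monicE lead_coefZ mulVf.
  - by rewrite !size_scale ?invr_eq0.
  - by rewrite !size_scale.
  have scal (r : K) u v : r != 0 -> (r^-1 *: u)^:P * (r *: v)%:P = u^:P * v%:P.
    move=> r0; rewrite map_polyZ /= -!mul_polyC polyCM.
    by rewrite mulrACA -polyCM -polyCM mulVf // mul1r.
  by rewrite /separated !scal.
left.
have ac' : (size a <= size c)%N.
  by have := size_separated K0 a0 b0 px0 e; rewrite leq_eqVlt (negPf ac).
have db' : (size d <= size b)%N.
  have := size_separated K0 d0 c0 px0' e'; rewrite leq_eqVlt => /orP[/eqP db|//].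
  (* Here deg d = deg b + 1 would give deg a = deg c + 1 after exchanging the variables. *)
  by case/eqP: ac; apply: (size_separated_swap K0 d0 c0 b0 px0' db e').
have [G bE] := separated_additive K0 a0 b0 c0 d0 px0 ac' e.
have [F cE] := separated_additive K0 d0 c0 b0 a0 px0' db' e'.
have F0 : F^`() != 0 by apply: contraNneq c0 => F0; rewrite cE F0 mulr0.
have G0 : G^`() != 0 by apply: contraNneq b0 => G0; rewrite bE G0 mulr0.
have [|Q pE] := @additive_structure _ K0 F G p F0 G0; last by exists Q, F, G.
(* With b = d G' and c = a F', the factor a(x) d(y) cancels. *)
have ad0 : a^:P * d%:P != 0 by rewrite mulf_neq0 ?map_polyC_eq0 ?polyC_eq0.
apply: (mulfI ad0); move: e; rewrite /separated bE cE !rmorphM rmorph1 /=.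
by rewrite !mul1r !mulr1 !mulrA (mulrAC a^:P) => ->; rewrite (mulrAC _ F^`()^:P).
Qed.

(** * Passage to iterated polynomials *)

Definition bipoly (P : {mpoly K[2]}) : {poly {poly K}} :=
  mmap (polyC \o polyC) (fun i : 'I_2 => if i == ord0 then 'X else 'X%:P) P.

Lemma horner_bipoly P x y : (bipoly P).[x%:P].[y] = eval2 P x y.
Proof.
rewrite -[_.[_]]/(horner_eval y (horner_eval x%:P _)) !rmorph_mmap.
apply: eq_mmap => [r|i] /=; first by rewrite !horner_evalE !hornerC.
rewrite !horner_evalE; case: i => -[|[|i]] lti //=; rewrite (tnth_nth x) /=.
  by rewrite hornerX hornerC.
by rewrite hornerC hornerX.
Qed.

Lemma deriv_bipoly P : (bipoly P)^`() = bipoly P^`M(ord0).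
Proof.
rewrite /bipoly (mmap_derivation _ _ (@derivD _) (@derivM _)); last first.
  by move=> r; rewrite /= derivC.
by rewrite big_ord_recl big_ord1 /= derivX derivC mulr1 mulr0 addr0.
Qed.

Lemma derivY_bipoly P : derivY (bipoly P) = bipoly P^`M(ord_max).
Proof.
have -> : ord_max = lift ord0 ord0 :> 'I_2 by apply/val_inj.
rewrite /bipoly (mmap_derivation _ _ (@derivYD K) (@derivYM K)); last first.
  by move=> r; rewrite /= derivY_polyC derivC.
rewrite big_ord_recl big_ord1 /= derivY_polyC derivX mulr1.
by rewrite -[X in derivY X](map_polyX polyC) derivY_map mulr0 add0r.
Qed.

Lemma bipoly_vanish p : (forall m n : nat, p.[m%:R%:P].[n%:R] = 0) -> p = 0.
Proof.
move=> p0; have inj : injective (fun m => m%:R%:P : {poly K}).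
  by move=> m n /polyC_inj/(natr_inj_char0 K0).
apply: (vanish_on_infinite inj) => m.
exact: (vanish_on_infinite (natr_inj_char0 K0)).
Qed.

Lemma bipoly_neq0 P : P != 0 -> bipoly P != 0.
Proof.
move=> /(eval2_neq0 K0)[m [n]]; rewrite -horner_bipoly.
by apply: contraNneq => ->; rewrite !horner0.
Qed.

Lemma horner2_map a x y : a^:P.[x%:P].[y] = a.[x].
Proof. by rewrite horner_map /= hornerC. Qed.

Lemma horner2_comp Q p x y : (Q^:P \Po p).[x%:P].[y] = Q.[p.[x%:P].[y]].
Proof. by rewrite horner_comp -[Q^:P.[_]]/(Q \Po _) horner_comp. Qed.

(** The second and fourth points are fixed at m and n, where neither derivative vanishes. Besides
    P_x and P_y, each remaining factor depends on one variable only and is nonzero because of its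
    value at (m, n). Checking at natural points suffices. *)
Lemma separated_bipoly P :
  P^`M(ord0) != 0 -> P^`M(ord_max) != 0 ->
  (forall x y z w : K,
    let Px := eval2 P^`M(ord0) in let Py := eval2 P^`M(ord_max) in
    Px x z * Py x w * Py y z * Px y w = Px x w * Px y z * Py x z * Py y w) ->
  exists a b c d, [/\ a != 0, b != 0, c != 0 & d != 0] /\
    separated a b c d (bipoly P).
Proof.
set P1 := P^`M(ord0); set P2 := P^`M(ord_max) => P10 P20 /= id.
have [m [n mn]] := eval2_neq0 K0 (mulf_neq0 P10 P20).
have {mn} [r10 r20] : eval2 P1 m%:R n%:R != 0 /\ eval2 P2 m%:R n%:R != 0.
  by apply/andP; rewrite -negb_or -mulf_eq0 -mevalM.
pose sx q : {poly K} := (swapXY (bipoly q)).[n%:R%:P].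
pose sy q : {poly K} := (bipoly q).[m%:R%:P].
have sxE q x : (sx q).[x] = eval2 q x n%:R.
  by rewrite horner2_swapXY horner_bipoly.
have syE q y : (sy q).[y] = eval2 q m%:R y by rewrite horner_bipoly.
have sx0 q : eval2 q m%:R n%:R != 0 -> sx q != 0.
  by rewrite -sxE; apply: contraNneq => ->; rewrite horner0.
have sy0 q : eval2 q m%:R n%:R != 0 -> sy q != 0.
  by rewrite -syE; apply: contraNneq => ->; rewrite horner0.
exists (eval2 P1 m%:R n%:R *: sx P2), (sy P2).
exists (eval2 P2 m%:R n%:R *: sx P1), (sy P1).
split; first by split; rewrite ?scaler_eq0 ?negb_or ?r10 ?r20 ?sx0 ?sy0.
rewrite /separated deriv_bipoly derivY_bipoly; apply/eqP; rewrite -subr_eq0.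
apply/eqP; apply: bipoly_vanish => i j.
rewrite !(hornerD, hornerN, hornerM) !horner2_map !hornerC !hornerZ.
rewrite !sxE !syE !horner_bipoly -/P1 -/P2.
apply/eqP; rewrite subr_eq0; apply/eqP.
transitivity (eval2 P1 i%:R j%:R * eval2 P2 i%:R n%:R
  * eval2 P2 m%:R j%:R * eval2 P1 m%:R n%:R).
  by ring.
by rewrite id; ring.
Qed.

End Structure.

(** * Characteristic zero of the ultraproduct, and the theorem *)

Lemma ultraproduct_char0 (alpha : set_system nat) (UF : UltraFilter alpha)
    (Fn : nat -> finFieldType) : ultra_char0 alpha Fn ->
  forall n, n.+1%:R != 0 :> ultraproduct UF Fn.
Proof.
move=> char0.
(* Naturals are ultralimits of constant sequences, so p = 0 in the ultraproduct means that almost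
   all [Fn n] have characteristic p. *)
have natE k : k%:R = ulim UF (fun n => k%:R : Fn n) :> ultraproduct UF Fn.
  elim: k => [|k IH]; first by rewrite mulr0n -ulim0.
  rewrite -natr1 IH -(ulim1 UF Fn) ulimD.
  by apply/ulimP; apply: filterE => n; rewrite natr1.
have pchar0 : [pchar ultraproduct UF Fn] =i pred0.
  move=> p; apply/negbTE/negP => /andP[p_prime /eqP].
  rewrite natE -(ulim0 UF Fn) => /ulimP h; apply: (char0 p p_prime).
  by apply: filterS h => n /= pn0; rewrite inE p_prime; apply/eqP.
by move=> n; move/(pcharf0P _): pchar0 => ->.
Qed.

Theorem theorem7p5
  (alpha : set_system nat) (UF : UltraFilter alpha) (NP : nonprincipal alpha)
  (Fn : nat -> finFieldType) (char0 : ultra_char0 alpha Fn)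
  (Fbar : closedFieldType) (iota : {rmorphism ultraproduct UF Fn -> Fbar})
  (Fbar_closure : is_algebraic_closure iota)
  (P : {mpoly (ultraproduct UF Fn)[2]})
  (not_dense : ~ zariski_dense (quad_values iota P)) :
  (exists Q F G : {poly (ultraproduct UF Fn)},
     forall x y : ultraproduct UF Fn, eval2 P x y = Q.[F.[x] + G.[y]])
  \/
  (exists Q F G : {poly (ultraproduct UF Fn)},
     forall x y : ultraproduct UF Fn, eval2 P x y = Q.[F.[x] * G.[y]]).
Proof.
have K0 := ultraproduct_char0 UF char0.
have A0 := natr_poly_char0 K0.
(* If a partial derivative vanishes, P depends on one variable only and is additive with Q the
   identity. *)
have [Px0|Px0] := eqVneq P^`M(ord0) 0.
  left; have /(deriv_eq0_const A0) pE : (bipoly P)^`() = 0.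
    by rewrite deriv_bipoly Px0 /bipoly mmap0.
  exists 'X, 0, (bipoly P)`_0 => x y.
  by rewrite -horner_bipoly pE hornerC hornerX horner0 add0r coefC.
have [Py0|Py0] := eqVneq P^`M(ord_max) 0.
  left; have /(derivY_eq0 K0) pE : derivY (bipoly P) = 0.
    by rewrite derivY_bipoly Py0 /bipoly mmap0.
  exists 'X, (swapXY (bipoly P))`_0, 0 => x y.
  by rewrite -horner_bipoly {1}pE horner2_map hornerX horner0 addr0.
have id := quad_jacobian K0 not_dense Px0 Py0.
have [a [b [c [d [[a0 b0 c0 d0] e]]]]] := separated_bipoly K0 Px0 Py0 id.
have px0 : (bipoly P)^`() != 0 by rewrite deriv_bipoly bipoly_neq0.
have py0 : derivY (bipoly P) != 0 by rewrite derivY_bipoly bipoly_neq0.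
have [[Q [F [G pE]]]|[Q [F [G pE]]]] :=
  separated_structure K0 a0 b0 c0 d0 px0 py0 e; [left | right];
  exists Q, F, G => x y; rewrite -horner_bipoly pE horner2_comp;
  by rewrite ?(hornerD, hornerM) horner2_map hornerC.
Qed.
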